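(* Let $G$ be a finite non-abelian group with centre $Z=Z(G)$, let $z=|Z|$, and suppose that $G/Z\cong D_{2n}$, the dihedral group of order $2n$. If $2\mid n$, then \begin{align*} \text{CN-spec}(\Gamma(G))=\Bigl\{&\bigl(-\bigl(\tfrac{(n-1)z}{2}-2\bigr)\bigr)^{\left(\frac{(n-1)z}{2}-1\right)},\ \bigl(\bigl(\tfrac{(n-1)z}{2}\bigr)^2-\tfrac{3(n-1)z}{2}+2\bigr)^1,\\ &\bigl(-\bigl(\tfrac{z}{2}-2\bigr)\bigr)^{2\left(\frac{z}{2}-1\right)},\ \bigl(\bigl(\tfrac{z}{2}\bigr)^2-\tfrac{3z}{2}+2\bigr)^2\Bigr\} \end{align*} and $$E_{CN}(\Gamma(G))=\frac{n^2z^2}{2}-nz^2-3nz+\frac{3z^2}{2}-3z+12.$$ If $2\nmid n$, then \begin{align*} \text{CN-spec}(\Gamma(G))=\Bigl\{&\bigl(-\bigl(\tfrac{(n-1)z}{2}-2\bigr)\bigr)^{\left(\frac{(n-1)z}{2}-1\right)},\ \bigl(\bigl(\tfrac{(n-1)z}{2}\bigr)^2-\tfrac{3(n-1)z}{2}+2\bigr)^1,\\ &(-(z-2))^{(z-1)},\ (z^2-3z+2)^1\Bigr\} \end{align*} and $$E_{CN}(\Gamma(G))=\frac{n^2z^2}{2}-nz^2-3nz+\frac{5z^2}{2}-3z+8.$$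
   Context: For a finite non-abelian group $G$, the commuting conjugacy class graph $\Gamma(G)$ is the simple undirected graph whose vertices are the conjugacy classes of the non-central elements of $G$; two distinct vertices $a^G$ and $b^G$ are adjacent if there exist $a'\in a^G$, $b'\in b^G$ with $a'b'=b'a'$. For a finite simple graph $\mathcal{G}$ with vertices $v_1,\dots,v_N$, the common neighbourhood matrix $CN(\mathcal{G})$ is the $N\times N$ matrix whose $(i,j)$ entry is, for $i\ne j$, the number of vertices other than $v_i,v_j$ adjacent to both $v_i$ and $v_j$, and is $0$ for $i=j$. The CN-spectrum $\text{CN-spec}(\mathcal{G})$ is the multiset of eigenvalues of $CN(\mathcal{G})$; writing $\{\lambda_1^{\alpha_1},\dots,\lambda_k^{\alpha_k}\}$ means that $\lambda_i$ is listed $\alpha_i$ times (multiplicities of coinciding values add up; entries with exponent $0$ are absent). The CN-energy $E_{CN}(\mathcal{G})$ is the sum of the absolute values of the eigenvalues of $CN(\mathcal{G})$, counted with multiplicity. *)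

(* Defs.v *)
From mathcomp Require Import all_boot all_order all_algebra all_fingroup.
From mathcomp Require Import all_solvable all_field.

Set Implicit Arguments.
Unset Strict Implicit.
Unset Printing Implicit Defensive.

Import GRing.Theory Num.Theory.

Record sgraph := SGraph {
  vertex : finType;
  adj : rel vertex;
  adj_sym : symmetric adj;
  adj_irrefl : irreflexive adj
}.

Section CommonNeighbourhood.

Local Open Scope ring_scope.

(* The roots of the characteristic polynomial, each repeated according to its
   multiplicity; the order is arbitrary, so spectra are compared by perm_eq. *)
Definition eigenvalues (n : nat) (A : 'M[algC]_n) : seq algC :=
  sval (closed_field_poly_normal (char_poly A)).

Lemma eigenvaluesP (n : nat) (A : 'M[algC]_n) :
  char_poly A = \prod_(x <- eigenvalues A) ('X - x%:P).
Proof.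
rewrite /eigenvalues; case: closed_field_poly_normal => s /= {1}->.
by rewrite (monicP (char_poly_monic A)) scale1r.
Qed.

Variable X : sgraph.

Definition common_neighbours (u v : vertex X) : {set vertex X} :=
  [set w | [&& w != u, w != v, adj w u & adj w v]].

Definition CN_matrix : 'M[algC]_#|vertex X| :=
  \matrix_(i, j)
    (if i == j then 0 else #|common_neighbours (enum_val i) (enum_val j)|%:R).

Definition CN_spec : seq algC := eigenvalues CN_matrix.

Definition CN_energy : algC := \sum_(x <- CN_spec) `|x|.

End CommonNeighbourhood.

Section CommutingClassGraph.

Local Open Scope group_scope.

Variables (gT : finGroupType) (G : {group gT}).

Definition noncentral_classes : {set {set gT}} :=
  [set a ^: G | a in G :\: 'Z(G)].

Definition ccc_vertex : finType := {C : {set gT} | C \in noncentral_classes}.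

Definition ccc_adj : rel ccc_vertex := fun C D =>
  (C != D) && [exists a in val C, exists b in val D, a * b == b * a].

Lemma ccc_adj_sym : symmetric ccc_adj.
Proof.
suff h C D : ccc_adj C D -> ccc_adj D C by move=> C D; apply/idP/idP; apply: h.
case/andP=> neCD /exists_inP[a Ca /exists_inP[b Db /eqP ab]].
rewrite /ccc_adj eq_sym neCD; apply/exists_inP; exists b => //.
by apply/exists_inP; exists a => //; rewrite ab.
Qed.

Lemma ccc_adj_irrefl : irreflexive ccc_adj.
Proof. by move=> C; rewrite /ccc_adj eqxx. Qed.

Definition ccc_graph : sgraph := SGraph ccc_adj_sym ccc_adj_irrefl.

End CommutingClassGraph.

(* Main.v *)
Require Import Defs.
From mathcomp Require Import all_boot all_order all_algebra all_fingroup.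
From mathcomp Require Import all_solvable all_field.
From mathcomp Require Import ring.

(** Write Z for the centre of G and z for its order.  The reason behind the
    theorem is that the commuting class graph is a disjoint union of cliques.

    Let A be the preimage in G of the rotation subgroup of G / Z.  As A / Z is
    cyclic and Z is central in A, the group A is abelian; it has index 2 in G.
    Such a subgroup controls all centralisers of non-central elements: a
    subgroup that properly contains A is G itself, so a non-central element of
    A has centraliser A, and an element a outside A has as centraliser the union
    of Z and Z a.  Hence two distinct classes are adjacent in two cases only:
    both lie in A, or both lie outside A and have the same product with Z
    ([adj_ccc_index2]).  The centralisers also give the class sizes, 2 inside
    A and |A : Z| = n outside, and dividing the number of elements by the
    class size gives the number of vertices in each clique ([card_label_in],
    [card_label_out]): (n - 1) z / 2 for the clique of A.

    Outside A the cliques correspond to the classes of reflections of the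
    dihedral group.  The class of the reflection w is the coset of w modulo
    the squares of rotations ([class_reflection]), so there is one class if n
    is odd and there are two if n is even; the cliques have z and z / 2
    vertices respectively ([CN_spec_dihedral]).

    On the spectral side, two vertices of a clique with m vertices have the
    m - 2 others as common neighbours, so the block of the common neighbourhood
    matrix is (m - 2)(J - I), where J is the all-ones matrix.  The all-ones
    vector has eigenvalue (m - 2)(m - 1) and the differences of two basis
    vectors have eigenvalue - (m - 2); together they form an eigenbasis, which
    determines the characteristic polynomial ([CN_spec_cliques]). *)

Set Implicit Arguments.
Unset Strict Implicit.
Unset Printing Implicit Defensive.

Import GRing.Theory Num.Theory.
Local Open Scope ring_scope.

(** * The CN-spectrum of a disjoint union of cliques *)

(** The relation passes to characteristic matrices, and the determinant of P
    can be cancelled because polynomials over a field form a domain. *)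
Lemma char_poly_eigenbasis {F : fieldType} (N : nat) (A P : 'M[F]_N) (d : 'rV_N) :
  P \in unitmx -> A *m P = P *m diag_mx d ->
  char_poly A = \prod_i ('X - (d 0 i)%:P).
Proof.
move=> Pu AP; have detP0 : \det (map_mx polyC P) != 0.
  by rewrite det_map_mx polyC_eq0 -unitfE -unitmxE.
apply: (mulIf detP0); rewrite /char_poly -det_mulmx.
have -> : char_poly_mx A *m map_mx polyC P = map_mx polyC P *m char_poly_mx (diag_mx d).
  rewrite /char_poly_mx mulmxBl mulmxBr -!map_mxM AP; congr (_ - _).
  by rewrite mul_scalar_mx mul_mx_scalar.
rewrite det_mulmx mulrC; congr (_ * _).
have := char_poly_trig (diag_mx_is_trig d); rewrite /char_poly => ->.
by apply: eq_bigr => i _; rewrite mxE eqxx.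
Qed.

Section Cliques.
Context (X : sgraph) (L : eqType) (f : vertex X -> L).

Definition fibre (l : L) : {set vertex X} := [set v | f v == l].

(** The connected components are cliques, and f names the component. *)
Hypothesis adjE : forall u v : vertex X, adj u v = (u != v) && (f u == f v).

Lemma card_common_neighbours (u v : vertex X) : u != v ->
  #|common_neighbours u v| =
    if f u == f v then (#|fibre (f u)| - 2)%N else 0%N.
Proof.
move=> uv; case: ifP => fuv.
  have -> : common_neighbours u v = fibre (f u) :\ u :\ v.
    apply/setP=> w; rewrite !inE !adjE -(eqP fuv).
    by case: (w == u); case: (w == v); case: (f w == f u).
  rewrite (cardsD1 u (fibre _)) (cardsD1 v (_ :\ u)) !inE eq_sym uv eqxx.
  by rewrite [f v == _]eq_sym fuv addnA addKn.
apply/eqP; rewrite cards_eq0; apply/eqP/setP=> w; rewrite !inE !adjE.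
case: (w == u) => //=; case: (w == v) => //=.
by apply/negP=> /andP[/eqP-> ]; rewrite fuv.
Qed.

(** One vertex of each fibre is distinguished: in the eigenbasis it indexes
    the indicator vector of the fibre, and every other vertex v of the fibre
    indexes the difference of the basis vectors at v and at the representative. *)
Definition fibre_rep (v : vertex X) : vertex X := choose (fun w => f w == f v) v.

Lemma fibre_repP v : f (fibre_rep v) = f v.
Proof. exact/eqP/(@chooseP _ (fun w => f w == f v)). Qed.

Lemma fibre_rep_eq u v : f u = f v -> fibre_rep u = fibre_rep v.
Proof.
move=> fuv; rewrite /fibre_rep fuv; apply: (@choose_id _ (fun w => f w == f v)) => //=.
by rewrite fuv.
Qed.

Lemma fibre_repK v : fibre_rep (fibre_rep v) = fibre_rep v.
Proof. exact/fibre_rep_eq/fibre_repP. Qed.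

Let m v : algC := #|fibre (f v)|%:R.

(** Entries of the common neighbourhood matrix, of the matrix whose columns form
    the eigenbasis, and the eigenvalues.  Writing the first with the factor
    [m u - 2] in the field instead of a truncated subtraction costs nothing: for a
    one-vertex fibre the other factor vanishes. *)
Let M (u v : vertex X) : algC :=
  (m u - 2) * ((f u == f v)%:R - (u == v)%:R).

Let B (u v : vertex X) : algC :=
  if v == fibre_rep v then (f u == f v)%:R
  else (u == v)%:R - (u == fibre_rep v)%:R.

Let D (v : vertex X) : algC :=
  if v == fibre_rep v then (m v - 2) * (m v - 1) else - (m v - 2).

Lemma sum_fibre u : \sum_w (f u == f w)%:R = m u.
Proof.
rewrite /m -natr_sum -sum1_card; congr (_%:R).
by rewrite [RHS]big_mkcond; apply: eq_bigr => w _; rewrite inE eq_sym; case: eqP.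
Qed.

Lemma sum_delta (u : vertex X) (F : vertex X -> algC) :
  \sum_w (w == u)%:R * F w = F u.
Proof.
rewrite (bigD1 u) //= eqxx mul1r big1 ?addr0 // => w /negPf->.
by rewrite mul0r.
Qed.

Lemma sum_M u (F : vertex X -> algC) :
  \sum_w M u w * F w = (m u - 2) * (\sum_w (f u == f w)%:R * F w - F u).
Proof.
rewrite -[F u]sum_delta -sumrB mulr_sumr; apply: eq_bigr => w _.
by rewrite /M [u == w]eq_sym -mulrA; congr (_ * _); rewrite mulrBl.
Qed.

(** On the fibre of u, M acts as m u - 2 times (J - I).  Against the
    indicator of that fibre J gives m u; against a difference of two basis
    vectors from one fibre it gives 0. *)
Lemma M_eigen u v : \sum_w M u w * B w v = B u v * D v.
Proof.
rewrite sum_M /B /D; case: ifP => vr.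
  have [fuv|fuv] := eqVneq (f u) (f v).
    rewrite /m fuv -/(m v) mul1r -[X in _ = _ * (X - 1)](sum_fibre v).
    congr (_ * (_ - _)); apply: eq_bigr => w _.
    by rewrite [f w == _]eq_sym; case: eqP; rewrite ?mulr0 ?mulr1.
  rewrite big1 ?subr0 ?mulr0 ?mul0r // => w _.
  have [<-|_] := eqVneq (f u) (f w); last by rewrite mul0r.
  by rewrite (negPf fuv) mulr0.
rewrite (_ : \sum_w _ = 0).
  have [->|uv] := eqVneq u v; first by ring.
  have [ur|ur] := eqVneq u (fibre_rep v); last by ring.
  by rewrite /m ur fibre_repP -/(m v); ring.
under eq_bigr do rewrite mulrC mulrBl.
by rewrite sumrB !sum_delta fibre_repP subrr.
Qed.

(** Orthogonality to the differences makes x constant on each fibre, and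
    orthogonality to the indicator then makes that constant times the size of
    the fibre vanish. *)
Lemma B_injective (x : vertex X -> algC) :
  (forall v, \sum_u x u * B u v = 0) -> forall v, x v = 0.
Proof.
move=> xB.
have x_rep v : x v = x (fibre_rep v).
  have [{1}->//|vr] := eqVneq v (fibre_rep v).
  have := xB v; rewrite /B (negPf vr).
  under eq_bigr do rewrite mulrC mulrBl.
  by rewrite sumrB !sum_delta => /eqP; rewrite subr_eq0 => /eqP.
move=> v; rewrite x_rep; set r := fibre_rep v.
have := xB r; rewrite /B fibre_repK eqxx.
rewrite (_ : \sum_u _ = x r * m r) => [/eqP|]; last first.
  rewrite -sum_fibre mulr_sumr; apply: eq_bigr => u _; rewrite [f r == _]eq_sym.
  have [fur|_] := eqVneq (f u) (f r); last by rewrite !mulr0.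
  by rewrite x_rep (fibre_rep_eq fur) fibre_repK.
rewrite mulf_eq0 /m pnatr_eq0 cards_eq0 => /orP[/eqP//|/eqP/setP/(_ r)].
by rewrite !inE eqxx.
Qed.

Lemma sum_enum_val (F : vertex X -> algC) :
  \sum_(i < #|vertex X|) F (enum_val i) = \sum_v F v.
Proof.
rewrite (reindex _ (onW_bij _ (enum_rank_bij (vertex X)))).
by apply: eq_bigr => v _; rewrite enum_rankK.
Qed.

Lemma char_poly_CN : char_poly (CN_matrix X) = \prod_v ('X - (D v)%:P).
Proof.
pose P : 'M[algC]_#|vertex X| := \matrix_(i, j) B (enum_val i) (enum_val j).
rewrite (@char_poly_eigenbasis _ _ _ P (\row_i D (enum_val i))).
- rewrite (reindex _ (onW_bij _ (enum_rank_bij (vertex X)))).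
  by apply: eq_bigr => v _; rewrite mxE enum_rankK.
- rewrite -row_free_unit; apply: inj_row_free => y /rowP yP.
  apply/rowP=> i; rewrite mxE -[i]enum_valK.
  apply: (@B_injective (fun v => y 0 (enum_rank v))) => v.
  rewrite -sum_enum_val; have := yP (enum_rank v); rewrite !mxE; apply: etrans.
  by apply: eq_bigr => j _; rewrite !mxE enum_rankK enum_valK.
apply/matrixP=> i j; rewrite mul_mx_diag !mxE -M_eigen -sum_enum_val.
apply: eq_bigr => k _; rewrite !mxE; congr (_ * _); rewrite /M.
have [->|ik] := eqVneq i k; first by rewrite !eqxx subrr mulr0.
have uv : enum_val i != enum_val k by rewrite (inj_eq enum_val_inj).
rewrite card_common_neighbours // (negPf uv) subr0.
case: eqP => fuv; rewrite ?mulr0 // mulr1 natrB //.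
rewrite (cardsD1 (enum_val i)) (cardsD1 (enum_val k)) !inE eqxx fuv eqxx.
by rewrite eq_sym uv.
Qed.

End Cliques.

(** The CN-spectrum of the complete graph on m vertices, for m > 0. *)
Definition clique_CN_spec (m : nat) : seq algC :=
  (m%:R - 2) * (m%:R - 1) :: nseq (m - 1) (- (m%:R - 2)).

(** The eigenvalues attached to the eigenbasis are grouped by fibre, each of which
    contains exactly one representative. *)
Lemma CN_spec_cliques (X : sgraph) (L : eqType) (f : vertex X -> L) (s : seq L) :
  (forall u v, adj u v = (u != v) && (f u == f v)) ->
  uniq s -> s =i codom f ->
  perm_eq (CN_spec X) (flatten [seq clique_CN_spec #|fibre f l| | l <- s]).
Proof.
move=> adjE Us sf; apply: prod_XsubC_eq.
rewrite -eigenvaluesP (char_poly_CN adjE) big_flatten big_map /=.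
rewrite (eq_bigr (fun v => \prod_(l <- s | l == f v)
  ('X - (if v == fibre_rep f v then (#|fibre f l|%:R - 2) * (#|fibre f l|%:R - 1)
         else - (#|fibre f l|%:R - 2))%:P))); last first.
  by move=> v _; rewrite -big_filter filter_pred1_uniq ?sf ?codom_f ?big_seq1.
rewrite (exchange_big_dep predT) //= big_seq [RHS]big_seq.
apply: eq_bigr => l; rewrite sf => /codomP[v0 ->]; rewrite /clique_CN_spec big_cons.
rewrite (bigD1 (fibre_rep f v0)) ?fibre_repP //= fibre_repK eqxx; congr (_ * _).
transitivity (\prod_(v in fibre f (f v0) :\ fibre_rep f v0)
    ('X - (- (#|fibre f (f v0)|%:R - 2) : algC)%:P)).
  apply: eq_big => v; first by rewrite !inE eq_sym andbC.
  case/andP=> /eqP/esym fv vr.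
  by rewrite (fibre_rep_eq fv) (negPf vr).
rewrite prodr_const big_nseq iter_mulr_1; congr (_ ^+ _).
by rewrite [in RHS](cardsD1 (fibre_rep f v0)) inE fibre_repP eqxx add1n subn1.
Qed.

(** For m = 1 the only eigenvalue, (-1) * 0, vanishes; for m > 1 all signs are
    known since m - 2 is a natural number. *)
Lemma clique_CN_energy (m : nat) : (0 < m)%N ->
  \sum_(x <- clique_CN_spec m) `|x| = 2 * (m%:R - 1) * (m%:R - 2).
Proof.
case: m => // -[|m] _.
  by rewrite big_cons big_nil subrr mulr0 normr0 addr0 mulr0 mul0r.
rewrite /clique_CN_spec big_cons big_nseq iter_addr_0 normrN.
have e : (m.+2%:R : algC) - 2 = m%:R by rewrite -addn2 natrD addrK.
have e1 : (m.+2%:R : algC) - 1 = m.+1%:R by rewrite -addn1 natrD addrK.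
rewrite e e1 -natrM !normr_nat subn1 /= -mulr_natr natrM; ring.
Qed.

Local Close Scope ring_scope.
Local Open Scope group_scope.

(** * Conjugacy classes of a group with an abelian subgroup of index 2 *)

Section Classes.
Context (gT : finGroupType) (G : {group gT}).

Lemma noncentral_classP (C : ccc_vertex G) :
  exists2 a, a \in G :\: 'Z(G) & val C = a ^: G.
Proof. by case: C => C /= /imsetP. Qed.

Lemma ccc_vertex_of a : a \in G :\: 'Z(G) -> exists C : ccc_vertex G, val C = a ^: G.
Proof.
move=> aGZ; have h : a ^: G \in noncentral_classes G by apply/imsetP; exists a.
by exists (exist (fun D => D \in noncentral_classes G) _ h).
Qed.

Lemma class_sub_invariant (S : {set gT}) b :
  (forall x g, x \in S -> g \in G -> x ^ g \in S) ->
  (b ^: G \subset S) = (b \in S).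
Proof.
move=> inv; apply/subsetP/idP => [|bS]; first by apply; apply: class_refl.
by move=> _ /imsetP[g gG ->]; apply: inv.
Qed.

(** The classes contained in S partition S. *)
Lemma card_classes_in (S : {set gT}) (k : nat) :
  S \subset G :\: 'Z(G) ->
  (forall x g, x \in S -> g \in G -> x ^ g \in S) ->
  (forall x, x \in S -> #|x ^: G| = k) ->
  (#|[set C : ccc_vertex G | val C \subset S]| * k)%N = #|S|.
Proof.
move=> sS inv card_cl.
have actS : [acts G, on S | 'J].
  by apply/subsetP=> g gG; rewrite !inE; apply/subsetP=> x xS; rewrite inE inv.
rewrite (card_uniform_partition (n := k) _ (orbit_partition actS)); last first.
  by move=> _ /imsetP[x xS ->]; rewrite orbitJ card_cl.
rewrite -(card_imset _ val_inj); congr (#|(_ : {set _})| * _)%N.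
apply/setP=> C; apply/imsetP/imsetP => [[D] | [x xS ->]].
  rewrite inE => sDS ->; have [a aGZ aD] := noncentral_classP D.
  exists a; last by rewrite orbitJ.
  by move: sDS; rewrite aD class_sub_invariant.
have [D Dx] := ccc_vertex_of (subsetP sS _ xS).
by exists D; rewrite ?orbitJ // inE Dx class_sub_invariant.
Qed.

End Classes.

Section AbelianIndexTwo.
Context (gT : finGroupType) (G A : {group gT}).
Hypotheses (nabG : ~~ abelian G) (sAG : A \subset G) (abA : abelian A).
Hypothesis (iA : #|G : A| = 2).

(** A subgroup of index 2 is maximal; this is how every centraliser below is
    determined. *)
Lemma index2_eq (H : {group gT}) x :
  A \subset H -> H \subset G -> x \in H -> x \notin A -> H = G.
Proof.
move=> sAH sHG xH xA; apply/val_inj/eqP; rewrite eqEsubset sHG /=.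
rewrite -(setID G A) (setIidPr sAG) subUset sAH.
rewrite -(rcoset_index2 (x := x) sAG iA) ?inE ?xA ?(subsetP sHG) //.
by rewrite mul_subG // sub1set.
Qed.

(** The centraliser of a contains A and x, so it is all of G. *)
Lemma cent1_index2 a x : a \in A -> x \in 'C_G[a] -> x \notin A -> a \in 'Z(G).
Proof.
move=> aA xC xA; have sAC : A \subset 'C_G[a].
  by rewrite subsetI sAG sub_cent1 (subsetP abA).
have /(congr1 val)/= eC := index2_eq sAC (subsetIl _ _) xC xA.
rewrite inE (subsetP sAG) //= -sub_cent1 -eC; exact: subsetIr.
Qed.

(** A central element outside A would make A central, and G, being generated by A
    and that element, abelian. *)
Lemma center_sub_index2 : 'Z(G) \subset A.
Proof.
apply/subsetP=> x xZ; apply: contraNT nabG => xA.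
have /centerP[xG cxG] := xZ.
have sAZ : A \subset 'Z(G).
  apply/subsetP=> a aA; apply: (cent1_index2 aA _ xA).
  by rewrite inE xG; apply/cent1P; apply: cxG; apply: (subsetP sAG).
have /(congr1 val)/= <- := index2_eq sAZ (center_sub G) xZ xA.
exact: center_abelian.
Qed.

Lemma card_class_in a : a \in A -> a \notin 'Z(G) -> #|a ^: G| = 2.
Proof.
move=> aA aZ; rewrite -index_cent1 -iA; congr #|_ : _|.
apply/eqP; rewrite eqEsubset subsetI sAG sub_cent1 (subsetP abA a aA) !andbT.
by apply/subsetP=> x xC; apply: contraNT aZ; apply: cent1_index2.
Qed.

(** An element of A that commutes with a is central by [cent1_index2]; one
    outside A differs from a by an element of A, which is then central. *)
Lemma cent1_out a : a \in G -> a \notin A ->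
  'C_G[a] = 'Z(G) :|: 'Z(G) :* a.
Proof.
move=> aG aA; have aaC : a \in 'C_G[a] by rewrite inE aG cent1id.
have key b : b \in A -> b \in 'C_G[a] -> b \in 'Z(G).
  move=> bA /setIP[bG bC]; apply: (cent1_index2 bA _ aA).
  by rewrite inE aG cent1C.
have sZC : 'Z(G) \subset 'C_G[a].
  apply/subsetP=> x /centerP[xG cx]; rewrite inE xG.
  by apply/cent1P; apply: cx.
apply/eqP; rewrite eqEsubset subUset sZC mul_subG ?sub1set // !andbT.
apply/subsetP=> b bC; rewrite inE.
have [bA|bA] := boolP (b \in A); first by rewrite key.
apply/orP; right; rewrite mem_rcoset; apply: key; last by rewrite groupM ?groupV.
by rewrite -mem_rcoset (rcoset_index2 sAG iA) inE ?aA // bA; case/setIP: bC.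
Qed.

Lemma card_class_out a : a \in G -> a \notin A -> #|a ^: G| = #|A : 'Z(G)|.
Proof.
move=> aG aA; have aZ : a \notin 'Z(G).
  by apply: contra aA; apply/subsetP/center_sub_index2.
have cC : #|'C_G[a]| = (2 * #|'Z(G)|)%N.
  rewrite (cent1_out aG aA) cardsU card_rcoset (_ : _ :&: _ = set0).
    by rewrite cards0 subn0 mul2n addnn.
  apply/setP=> b; rewrite in_setI in_set0 mem_rcoset; apply/negP=> /andP[bZ baZ].
  by rewrite (groupMl _ bZ) groupV (negPf aZ) in baZ.
have := Lagrange (subsetIl G 'C[a]); rewrite index_cent1 cC.
rewrite -(Lagrange sAG) iA -(Lagrange center_sub_index2).
rewrite -mulnA mulnC => /eqP.
by rewrite eqn_pmul2r // eqn_pmul2l ?cardG_gt0 // => /eqP.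
Qed.

(** The name of the component of the commuting class graph that contains the
    class C.  Outside A it is the union of the translates of C by the centre,
    that is, the preimage of a class of the central quotient. *)
Definition class_label (C : {set gT}) : {set gT} :=
  if C \subset A then A : {set gT} else 'Z(G) * C.

Lemma class_label_in a : a \in A -> class_label (a ^: G) = A.
Proof.
move=> aA; rewrite /class_label class_sub_norm ?aA //.
by have /andP[] := index2_normal sAG iA.
Qed.

Lemma class_label_out a : a \notin A -> class_label (a ^: G) = 'Z(G) * a ^: G.
Proof.
move=> aA; rewrite /class_label; case: ifP => // /subsetP/(_ _ (class_refl _ _)).
by rewrite (negPf aA).
Qed.

Lemma mem_class_centerM a : a \in 'Z(G) * a ^: G.
Proof. by rewrite -{1}[a]mul1g mem_mulg ?class_refl ?group1. Qed.

Lemma conj_center x g : x \in 'Z(G) -> g \in G -> x ^ g = x.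
Proof. by case/centerP=> _ cx gG; apply/conjg_fixP/commgP; apply: cx. Qed.

Lemma class_centerM_sub x a : x \in 'Z(G) ->
  'Z(G) * (x * a) ^: G \subset 'Z(G) * a ^: G.
Proof.
move=> xZ; apply/subsetP=> _ /mulsgP[y _ yZ /imsetP[g gG ->] ->].
by rewrite conjMg conj_center // mulgA mem_mulg ?groupM // memJ_class.
Qed.

Lemma class_centerM x a : x \in 'Z(G) ->
  'Z(G) * (x * a) ^: G = 'Z(G) * a ^: G.
Proof.
move=> xZ; apply/eqP; rewrite eqEsubset class_centerM_sub //=.
by rewrite -{1}[a](mulKg x) class_centerM_sub ?groupV.
Qed.

(** Z * b ^: G is the preimage of a class of the central quotient, so each of its
    elements represents it. *)
Lemma class_centerM_eqP a b :
  reflect ('Z(G) * a ^: G = 'Z(G) * b ^: G) (a \in 'Z(G) * b ^: G).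
Proof.
apply: (iffP idP) => [/mulsgP[x _ xZ /imsetP[g gG ->] ->] | <-].
  by rewrite class_centerM // classGidl.
exact: mem_class_centerM.
Qed.

Lemma class_centerM_out a b :
  a \in G -> a \notin A -> b \in 'Z(G) * a ^: G -> b \notin A.
Proof.
have /andP[_ nAG] := index2_normal sAG iA.
move=> aG aA /mulsgP[x _ xZ /imsetP[g gG ->] ->].
by rewrite (groupMl _ (subsetP center_sub_index2 _ xZ)) memJ_norm ?(subsetP nAG).
Qed.

Lemma commuting_labels a b :
    a \in G :\: 'Z(G) -> b \in G :\: 'Z(G) -> a * b = b * a ->
  class_label (a ^: G) = class_label (b ^: G).
Proof.
case/setDP=> aG aZ /setDP[bG bZ] ab.
have [aA|aA] := boolP (a \in A).
  rewrite !class_label_in //; apply: contraNT aZ; apply: cent1_index2 => //.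
  by rewrite inE bG; apply/cent1P.
have bC : b \in 'C_G[a] by rewrite inE bG; apply/cent1P.
move: bC; rewrite (cent1_out aG aA) inE (negPf bZ) /= => /rcosetP[x xZ eb].
have xaA : x * a \notin A by rewrite (groupMl _ (subsetP center_sub_index2 _ xZ)).
by rewrite eb (class_label_out aA) (class_label_out xaA) class_centerM.
Qed.

(** Conversely to [commuting_labels], classes inside A commute since A is
    abelian, and if b = x c with x central and c in the class of a, then c and b
    commute. *)
Lemma adj_ccc_index2 (C D : vertex (ccc_graph G)) :
  adj C D = (C != D) && (class_label (val C) == class_label (val D)).
Proof.
rewrite -[adj C D]/(ccc_adj C D) /ccc_adj; congr (_ && _).
have [a aGZ Ca] := noncentral_classP C; have [b bGZ Db] := noncentral_classP D.
have nGZ : G \subset 'N(G :\: 'Z(G)).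
  by rewrite normsD ?normG // normal_norm // center_normal.
rewrite Ca Db; apply/exists_inP/eqP => [[x xC] /exists_inP[y yC /eqP xy]|lab].
  rewrite -(class_eqP xC) -(class_eqP yC); apply: commuting_labels => //.
    by apply: subsetP xC; rewrite class_sub_norm.
  by apply: subsetP yC; rewrite class_sub_norm.
have [/setDP[aG aZ] /setDP[bG bZ]] := (aGZ, bGZ).
have [aA|aA] := boolP (a \in A).
  have bA : b \in A.
    apply: contraTT isT => bA; move: lab; rewrite class_label_in // class_label_out //.
    by move=> eA; rewrite eA mem_class_centerM in bA.
  exists a; first exact: class_refl.
  apply/exists_inP; exists b; first exact: class_refl.
  by apply/eqP; apply: (centsP abA).
have bA : b \notin A.
  apply: contra (aA) => bA; move: lab; rewrite (class_label_in bA) class_label_out //.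
  by move=> <-; apply: mem_class_centerM.
move: lab; rewrite !class_label_out // => /esym/class_centerM_eqP.
case/mulsgP=> x c xZ cC eb; exists c => //; apply/exists_inP; exists b.
  exact: class_refl.
have cG : c \in G by apply: subsetP cC; rewrite class_sub_norm ?normG.
have /centerP[_ cx] := xZ.
by apply/eqP; rewrite eb mulgA (cx c cG).
Qed.

(** The classes labelled A are those contained in A minus the centre, and
    all of them have two elements. *)
Lemma card_label_in :
  (#|fibre (fun C : vertex (ccc_graph G) => class_label (val C)) A| * 2)%N
    = (#|A| - #|'Z(G)|)%N.
Proof.
have /andP[_ nAG] := index2_normal sAG iA.
rewrite -(setIidPr center_sub_index2) -cardsD -(@card_classes_in _ G (A :\: 'Z(G)) 2).
- congr (#|(_ : {set _})| * _)%N; apply/setP=> C; rewrite !inE.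
  have [a /setDP[aG aZ] ->] := noncentral_classP C.
  rewrite class_sub_norm ?normsD ?gFnorm // inE aZ /=.
  apply/eqP/idP => [|aA]; last exact: class_label_in.
  apply: contraPT => aA; rewrite class_label_out // => eA.
  by rewrite -eA mem_class_centerM in aA.
- exact: setSD.
- by move=> x g xS gG; rewrite memJ_norm // (subsetP _ _ gG) // normsD ?gFnorm.
by move=> x /setDP[xA xZ]; apply: card_class_in.
Qed.

(** The classes with this label are those contained in it, and all of them
    have |A : Z| elements. *)
Lemma card_label_out a : a \in G -> a \notin A ->
  (#|fibre (fun C : vertex (ccc_graph G) => class_label (val C)) ('Z(G) * a ^: G)%g|
    * #|A : 'Z(G)|)%N = #|('Z(G) * a ^: G)%g|.
Proof.
move=> aG aA; have sSG : 'Z(G) * a ^: G \subset G.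
  by rewrite mul_subG ?center_sub // class_sub_norm ?normG.
have inv x g : x \in 'Z(G) * a ^: G -> g \in G -> x ^ g \in 'Z(G) * a ^: G.
  case/mulsgP=> y c yZ cC -> gG.
  rewrite conjMg (conj_center yZ) // mem_mulg // memJ_norm //.
  exact: subsetP (class_norm a G) g gG.
rewrite -(@card_classes_in _ G ('Z(G) * a ^: G) #|A : 'Z(G)|) //.
- congr (#|(_ : {set _})| * _)%N; apply/setP=> C; rewrite !inE.
  have [b /setDP[bG bZ] ->] := noncentral_classP C.
  rewrite class_sub_invariant //.
  apply/eqP/idP => [|bS]; last first.
    by rewrite (class_label_out (class_centerM_out aG aA bS)); apply/class_centerM_eqP.
  have [bA|bA] := boolP (b \in A); last first.
    by rewrite class_label_out // => /class_centerM_eqP.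
  by rewrite class_label_in // => eA; rewrite eA mem_class_centerM in aA.
- apply/subsetP=> x xS; rewrite inE (subsetP sSG) // andbT.
  by apply: contra (class_centerM_out aG aA xS); apply/subsetP/center_sub_index2.
by move=> x xS; rewrite card_class_out ?(subsetP sSG) // (class_centerM_out aG aA).
Qed.

End AbelianIndexTwo.

(** * Conjugacy classes of a dihedral group *)

(** In the presentation x^n = y^2 = 1, x^y = x^-1 the group is the product of
    the cyclic groups of x and y; having 2n elements forces both relations on
    orders to be sharp. *)
Lemma dihedral_rotation (gT : finGroupType) (Q : {group gT}) (n : nat) :
    (1 < n)%N -> Q \isog 'D_(2 * n) ->
  exists2 u, u \in Q & [/\ #[u] = n, #|Q : <[u]>| = 2
    & forall w, w \in Q :\: <[u]> -> u ^ w = u^-1].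
Proof.
move=> n_gt1 isoQ; have cQ : #|Q| = (2 * n)%N.
  by rewrite (card_isog isoQ) mul2n card_dihedral.
move: isoQ; rewrite mul2n => /isog_hom; rewrite Grp_dihedral //.
case/existsP=> -[u y] /= /eqP[eQ un y2 uy].
have nuy : <[y]> \subset 'N(<[u]>) by rewrite cycle_subG /= inE -cycleJ uy cycleV.
have sy : #[y] <= 2 by rewrite dvdn_leq // order_dvdn y2.
have su : #[u] <= n by rewrite dvdn_leq ?(ltnW n_gt1) // order_dvdn un.
rewrite /= norm_joinEr // in eQ.
have := mul_cardG <[u]> <[y]>; rewrite -!orderE eQ cQ => cprod.
have c_gt0 := cardG_gt0 (<[u]> :&: <[y]>).
have cprod_ge : 2 * n <= #[u] * #[y] by rewrite cprod leq_pmulr.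
have ou : #[u] = n.
  apply/eqP; rewrite eqn_leq su -(leq_pmul2l (ltn0Sn 1)) (leq_trans cprod_ge) //.
  by rewrite mulnC leq_mul2r sy orbT.
have oy : #[y] = 2.
  by apply/eqP; rewrite eqn_leq sy; move: cprod_ge; rewrite ou mulnC leq_pmul2l // ltnW.
have uQ : u \in Q by rewrite -cycle_subG -eQ mulG_subl.
have iQ : #|Q : <[u]>| = 2.
  have := Lagrange (G := Q) (H := <[u]>); rewrite cycle_subG => /(_ uQ).
  by rewrite -orderE ou cQ mulnC => /eqP; rewrite eqn_pmul2r ?(ltnW n_gt1) // => /eqP.
exists u => //; split=> // w /setDP[wQ wu].
move: wQ wu; rewrite -eQ => /mulsgP[a b au].
rewrite /= (cycle2g oy) !inE.
case/orP=> /eqP-> ->; first by rewrite mulg1 au.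
move=> _; rewrite conjgM (_ : u ^ a = u) //.
by case/cycleP: au => i ->; rewrite conjgE -expgS expgSr mulKg.
Qed.

(** Since w inverts u, conjugating w by u^i multiplies it by u^(-2i); and every
    element of Q is, up to a left factor w that fixes w, a power of u. *)
Lemma class_reflection (gT : finGroupType) (Q : {group gT}) (u w : gT) :
    u \in Q -> #|Q : <[u]>| = 2 ->
    (forall w, w \in Q :\: <[u]> -> u ^ w = u^-1) -> w \in Q :\: <[u]> ->
  w ^: Q = <[u ^+ 2]> :* w.
Proof.
move=> uQ iQ inv wQu; have su : <[u]> \subset Q by rewrite cycle_subG.
have conjX i : w ^ (u ^+ i) = (u ^+ 2) ^- i * w.
  have uw : u ^+ i * w = w * u ^- i by rewrite conjgC conjXg inv // expVgn.
  rewrite -expgM mulnC expgM expgS expg1 invMg conjgE -mulgA; congr (_ * _).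
  by apply: (mulgI (u ^+ i)); rewrite mulgA uw mulgKV mulKVg.
apply/eqP; rewrite eqEsubset; apply/andP; split; apply/subsetP=> x.
  case/imsetP=> g gQ ->.
  have conjK h : h \in <[u]> -> w ^ h \in <[u ^+ 2]> :* w.
    by case/cycleP=> i ->; rewrite conjX mem_rcoset mulgK groupV mem_cycle.
  have [|gu] := boolP (g \in <[u]>); first exact: conjK.
  have : g \in <[u]> :* w by rewrite (rcoset_index2 su iQ wQu) inE gu.
  rewrite norm_rlcoset; last first.
    have /andP[_ /subsetP] := index2_normal su iQ; apply; by case/setDP: wQu.
  by case/lcosetP=> h hu ->; rewrite conjgM [w ^ w]conjgE mulKg conjK.
case/rcosetP=> h; rewrite -groupV => /cycleP[i eh] ->.
by rewrite -[h]invgK eh -conjX memJ_class // groupX.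
Qed.

(** * Groups whose central quotient is dihedral *)

Section DihedralQuotient.
Context (gT : finGroupType) (G : {group gT}) (n : nat).
Local Notation Z := 'Z(G).
Hypotheses (nabG : ~~ abelian G) (n_gt1 : 1 < n) (isoGZ : G / Z \isog 'D_(2 * n)).

(** A is the preimage of the rotations and K that of the squares of rotations;
    the last conjunct is [class_reflection] pulled back to G. *)
Lemma dihedral_quotient_lift :
  exists (A K : {group gT}),
    [/\ [/\ A \subset G, abelian A, #|G : A| = 2 & #|A| = (#|Z| * n)%N],
        K \subset A, #|K| = (#|Z| * (n %/ gcdn n 2))%N
      & forall a, a \in G -> a \notin A -> Z * a ^: G = K :* a].
Proof.
have [u uQ [ou iQ inv]] := dihedral_rotation n_gt1 isoGZ.
have nZG : G \subset 'N(Z) by apply: normal_norm (center_normal G).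
have suQ : <[u]> \subset G / Z by rewrite cycle_subG.
pose A := (coset Z @*^-1 <[u]>)%G; pose K := (coset Z @*^-1 <[u ^+ 2]>)%G.
have sAG : A \subset G by rewrite -(quotientGK (center_normal G)) morphpreS.
have cA : #|A| = (#|Z| * n)%N by rewrite card_cosetpre -orderE ou.
have AZ : A / Z = <[u]> by rewrite cosetpreK.
have abA : abelian A.
  apply: (@cyclic_factor_abelian _ Z); last by rewrite /= AZ cycle_cyclic.
  have sZA : Z \subset A by rewrite -{1}(ker_coset Z) morphpreS // sub1G.
  rewrite subsetI sZA (subset_trans (subsetIr _ _)) // centS //.
exists A, K; split.
- split=> //; rewrite -iQ -(index_cosetpre (G / Z)%G <[u]>%G).
  by rewrite quotientGK // center_normal.
- by rewrite morphpreS // cycleX.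
- by rewrite card_cosetpre -orderE orderXgcd ou.
move=> a aG aA; have wQ : coset Z a \in G / Z :\: <[u]>.
  rewrite inE mem_quotient // andbT; apply: contra aA => au.
  by rewrite mem_morphpre // (subsetP nZG).
have sZK : Z \subset K by rewrite -{1}(ker_coset Z) morphpreS // sub1G.
have naG : a ^: G \subset 'N(Z) by rewrite (subset_trans _ nZG) // class_subG.
rewrite -(quotientK naG).
rewrite quotient_class ?(subsetP nZG) //.
rewrite (class_reflection uQ iQ inv wQ) cosetpreM.
rewrite cosetpre_set1 ?(subsetP nZG) // mulgA.
by congr (_ * _); apply: mulGSid.
Qed.

(** K is A or has index 2 in A according to the parity of n, so gcd(n, 2) is
    the number of cosets of K outside A, hence of cliques besides that of A.
    Such a clique has w vertices with w n = |K|. *)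
Lemma CN_spec_dihedral :
  exists M w : nat, [/\ (M * 2 = (n - 1) * #|Z|)%N, (w * gcdn n 2)%N = #|Z|, 0 < M &
    perm_eq (CN_spec (ccc_graph G))
      (clique_CN_spec M ++ flatten (nseq (gcdn n 2) (clique_CN_spec w)))].
Proof.
have [A [K [[sAG abA iA cA] sKA cK ZK]]] := dihedral_quotient_lift.
have sZA : Z \subset A := center_sub_index2 nabG sAG abA iA.
have z_gt0 : 0 < #|Z| := cardG_gt0 _.
have iAZ : #|A : Z| = n.
  by apply/eqP; rewrite -(eqn_pmul2l z_gt0) (Lagrange sZA) cA.
have [a0 a0A a0Z] : exists2 a, a \in A & a \notin Z.
  apply/subsetPn/negP=> /subset_leq_card; rewrite cA leqNgt.
  by rewrite -{1}[#|Z|]muln1 ltn_pmul2l ?n_gt1.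
have [a aG aA] : exists2 a, a \in G & a \notin A.
  apply/subsetPn/negP=> sGA; case/negP: nabG; exact: abelianS abA.
have notZ b : b \notin A -> b \notin Z by apply: contra; apply/subsetP.
pose f (C : vertex (ccc_graph G)) := class_label G A (val C).
have f_vertex b : b \in G -> b \notin Z -> class_label G A (b ^: G) \in codom f.
  move=> bG bZ; have [|C Cb] := @ccc_vertex_of _ G b; first by rewrite inE bG bZ.
  by rewrite -Cb; apply: codom_f.
have f_out b : b \in G -> b \notin A -> K :* b \in codom f.
  by move=> bG bA; rewrite -ZK // -(class_label_out G bA) f_vertex ?notZ.
have f_in : (A : {set gT}) \in codom f.
  by rewrite -(class_label_in sAG iA a0A) f_vertex // (subsetP sAG).
have neq_out b : b \notin A -> (A : {set gT}) != K :* b.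
  by apply: contraNneq => ->; apply: rcoset_refl.
have adjE := adj_ccc_index2 nabG sAG abA iA.
have cM := card_label_in nabG sAG abA iA.
have cw b : b \in G -> b \notin A -> (#|fibre f (K :* b)| * n)%N = #|K|.
  move=> bG bA; rewrite -ZK // -{1}iAZ (card_label_out nabG sAG abA iA bG bA).
  by rewrite ZK // card_rcoset.
have M2 : (#|fibre f A| * 2)%N = ((n - 1) * #|Z|)%N.
  by rewrite cM cA mulnBl mul1n mulnC.
exists #|fibre f A|; exists #|fibre f (K :* a)|; split=> //.
- apply/eqP; rewrite -(eqn_pmul2r (ltnW n_gt1)) mulnAC cw // cK -mulnA.
  by rewrite divnK ?dvdn_gcdl.
- by rewrite -(ltn_pmul2r (ltn0Sn 1)) M2 mul0n muln_gt0 subn_gt0 n_gt1.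
(* Odd n: the square of a rotation generates all rotations, so K = A. *)
have [oddn|evenn] := boolP (odd n).
  have g1 : (gcdn n 2 = 1)%N by apply/eqP; rewrite -/(coprime n 2) coprimen2.
  have eKA : K :=: A by apply/eqP; rewrite eqEcard sKA cK cA g1 divn1 leqnn.
  apply: perm_trans (CN_spec_cliques (s := [:: A : {set gT}; K :* a]) adjE _ _) _.
  - by rewrite /= inE neq_out.
  - move=> l; apply/idP/idP.
      by rewrite !inE => /orP[]/eqP->; [apply: f_in | apply: f_out].
    case/codomP=> C ->; have [b /setDP[bG bZ] Cb] := noncentral_classP C.
    rewrite /f Cb !inE; have [bA|bA] := boolP (b \in A).
      by rewrite class_label_in // eqxx.
    rewrite class_label_out // ZK // (_ : K :* b = K :* a) ?eqxx ?orbT //.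
    by apply: rcoset_eqP; rewrite eKA (rcoset_index2 sAG iA) ?inE ?bA ?aA.
  by rewrite g1 /= cats0.
(* Even n: the complement of A splits into the cosets of a and of x a, where x
   is any element of A outside K. *)
have g2 : (gcdn n 2 = 2)%N by apply/gcdn_idPr; rewrite dvdn2.
have iK : #|A : K| = 2.
  apply/eqP; rewrite -(eqn_pmul2l (cardG_gt0 K)) Lagrange // cK cA g2 -mulnA.
  by rewrite divnK // dvdn2.
have [x xA xK] : exists2 x, x \in A & x \notin K.
  by apply/subsetPn/negP; rewrite -indexg_eq1 iK.
have xaA : x * a \notin A by rewrite groupMl.
have xaG : x * a \in G := groupM (subsetP sAG x xA) aG.
have neq_xa : K :* a != K :* (x * a).
  by apply: contraNneq xK => /esym/rcoset_eqP; rewrite mem_rcoset mulgK.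
apply: perm_trans
  (CN_spec_cliques (s := [:: A : {set gT}; K :* a; K :* (x * a)]) adjE _ _) _.
- by rewrite /= !inE negb_or !neq_out ?neq_xa.
- move=> l; apply/idP/idP.
    by rewrite !inE => /or3P[]/eqP->; [apply: f_in | apply: f_out | apply: f_out].
  case/codomP=> C ->; have [b /setDP[bG bZ] Cb] := noncentral_classP C.
  rewrite /f Cb !inE; have [bA|bA] := boolP (b \in A).
    by rewrite class_label_in // eqxx.
  rewrite class_label_out // ZK //.
  have : b \in A :* a by rewrite (rcoset_index2 sAG iA) inE ?bA ?aA.
  case/rcosetP=> h hA ->; have [hK|hK] := boolP (h \in K).
    rewrite (_ : K :* (h * a) = K :* a) ?eqxx ?orbT //.
    by apply: rcoset_eqP; rewrite mem_rcoset mulgK.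
  rewrite (_ : K :* (h * a) = K :* (x * a)) ?eqxx ?orbT //.
  apply: rcoset_eqP; rewrite rcosetM mem_rcoset mulgK.
  by rewrite (rcoset_index2 sKA iK) inE ?xK ?hK.
have ew : #|fibre f (K :* (x * a))| = #|fibre f (K :* a)|.
  by apply/eqP; rewrite -(eqn_pmul2r (ltnW n_gt1)) !cw.
by rewrite g2 !map_cons ew; apply: perm_refl.
Qed.

End DihedralQuotient.

Local Close Scope group_scope.
Local Open Scope ring_scope.

(* 'D_m is the dihedral group of order m only for even m >= 4, hence 1 < n;
   for n = 1 the quotient would be cyclic and G abelian.  The nat divisions by
   2 in the multiplicities are exact, as z is even when n is even. *)
Theorem theorem2p14 (gT : finGroupType) (G : {group gT}) (n z : nat)
    (nabG : ~~ abelian G) (n_gt1 : (1 < n)%N)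
    (zE : z = #|'Z(G)%g|)
    (isoGZ : (G / 'Z(G))%g \isog ('D_(2 * n))%g) :
  let nC : algC := n%:R in
  let zC : algC := z%:R in
  ((2 %| n)%N ->
    perm_eq (CN_spec (ccc_graph G))
      (nseq ((n - 1) * z %/ 2 - 1) (- ((nC - 1) * zC / 2 - 2))
       ++ nseq 1 (((nC - 1) * zC / 2) ^+ 2 - 3 * (nC - 1) * zC / 2 + 2)
       ++ nseq (2 * (z %/ 2 - 1)) (- (zC / 2 - 2))
       ++ nseq 2 ((zC / 2) ^+ 2 - 3 * zC / 2 + 2))
    /\ CN_energy (ccc_graph G) =
         nC ^+ 2 * zC ^+ 2 / 2 - nC * zC ^+ 2 - 3 * nC * zC
         + 3 * zC ^+ 2 / 2 - 3 * zC + 12)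
  /\
  (~~ (2 %| n)%N ->
    perm_eq (CN_spec (ccc_graph G))
      (nseq ((n - 1) * z %/ 2 - 1) (- ((nC - 1) * zC / 2 - 2))
       ++ nseq 1 (((nC - 1) * zC / 2) ^+ 2 - 3 * (nC - 1) * zC / 2 + 2)
       ++ nseq (z - 1) (- (zC - 2))
       ++ nseq 1 (zC ^+ 2 - 3 * zC + 2))
    /\ CN_energy (ccc_graph G) =
         nC ^+ 2 * zC ^+ 2 / 2 - nC * zC ^+ 2 - 3 * nC * zC
         + 5 * zC ^+ 2 / 2 - 3 * zC + 8).
Proof.
move=> nC zC; have [M [w [M2 wz M_gt0 spec]]] := CN_spec_dihedral nabG n_gt1 isoGZ.
rewrite -zE in M2 wz.
have w_gt0 : (0 < w)%N.
  by have := cardG_gt0 'Z(G); rewrite -zE -wz muln_gt0 => /andP[].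
have -> : ((n - 1) * z %/ 2 = M)%N by rewrite -M2 mulnK.
have MC : (nC - 1) * zC = 2 * M%:R.
  by rewrite -natrM mulnC M2 natrM natrB // ltnW.
have M_half : (nC - 1) * zC / 2 = M%:R by rewrite MC; field.
have top : (M%:R : algC) ^+ 2 - 3 * (nC - 1) * zC / 2 + 2 = (M%:R - 2) * (M%:R - 1).
  by rewrite -!(mulrA 3) M_half; ring.
rewrite M_half top.
split=> n2.
  have g2 : (gcdn n 2 = 2)%N by apply/gcdn_idPr.
  rewrite g2 in wz spec.
  have zw : zC = 2 * w%:R by rewrite -natrM mulnC wz.
  have -> : (z %/ 2 = w)%N by rewrite -wz mulnK.
  split.
    apply: perm_trans spec _; rewrite (_ : zC / 2 = w%:R); last by rewrite zw; field.
    rewrite (_ : w%:R ^+ 2 - 3 * zC / 2 + 2 = (w%:R - 2) * (w%:R - 1)); last first.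
      by rewrite zw; field.
    apply/seq.permP=> p; rewrite /= cats0.
    rewrite !(count_cat, count_nseq) /= !(count_cat, count_nseq) /=.
    rewrite !count_nseq; ring.
  rewrite /CN_energy (perm_big _ spec) !big_cat /= !big_nil !clique_CN_energy // ?addr0.
  rewrite (_ : M%:R = (nC - 1) * zC / 2) // zw; by field.
have g1 : (gcdn n 2 = 1)%N.
  by apply/eqP; rewrite -/(coprime n 2) coprimen2; rewrite dvdn2 negbK in n2.
rewrite g1 muln1 in wz spec; rewrite wz in spec w_gt0.
split.
  apply: perm_trans spec _.
  rewrite (_ : zC ^+ 2 - 3 * zC + 2 = (zC - 2) * (zC - 1)); last by ring.
  apply/seq.permP=> p; rewrite /= cats0.
  rewrite !(count_cat, count_nseq) /= !(count_cat, count_nseq) /=.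
  ring.
rewrite /CN_energy (perm_big _ spec) !big_cat /= !big_nil !clique_CN_energy // ?addr0.
rewrite (_ : M%:R = (nC - 1) * zC / 2) // -/zC; by field.
Qed.
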